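(* Let $m\ge 1$, $n\ge 1$ and let $P(z)=A_0+A_1z+\cdots+A_mz^m$ be a matrix polynomial whose coefficients $A_i\in\mathbb{C}^{n\times n}$ satisfy $$A_m\ge A_{m-1}\ge\cdots\ge A_0\ge 0,\qquad A_m>0.$$ Then each eigenvalue $\lambda\in\mathbb{C}$ of $P(z)$ satisfies $$\frac{\lambda_{\min}(A_0)}{2\lambda_{\max}(A_m)}\le|\lambda|\le 1,$$ where $\lambda_{\min}(A_0)$ denotes the smallest eigenvalue of $A_0$ and $\lambda_{\max}(A_m)$ the largest eigenvalue of $A_m$.
   Context: A number $\lambda\in\mathbb{C}$ is an eigenvalue of the matrix polynomial $P(z)$ if there is a nonzero vector $x\in\mathbb{C}^n$ with $P(\lambda)x=0$. For $A\in\mathbb{C}^{n\times n}$, $A\ge 0$ means that $A$ is positive semidefinite, i.e. $x^*Ax\ge 0$ (real and nonnegative) for every $x\in\mathbb{C}^n$; $A>0$ means that $A$ is positive definite, i.e. $x^*Ax>0$ for every nonzero $x\in\mathbb{C}^n$; $A\ge B$ means $A-B\ge 0$. *)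

(* Defs.v *)
From HB Require Import structures.
From mathcomp Require Import all_boot all_order all_algebra.
From mathcomp Require Import all_classical reals.
From mathcomp Require Export complex.

Set Implicit Arguments.
Unset Strict Implicit.
Unset Printing Implicit Defensive.
Import Order.TTheory GRing.Theory Num.Theory.

Local Open Scope ring_scope.
Local Open Scope sesquilinear_scope.

Section Defs.
Context {C : numClosedFieldType}.

(* In the order of C, [0 <= z] means that z is real and nonnegative, and
   [0 < z] that z is real and positive. *)
Definition psdmx n (A : 'M[C]_n) : Prop :=
  forall x : 'cV[C]_n, 0 <= (x^t* *m A *m x) 0 0.

Definition pdmx n (A : 'M[C]_n) : Prop :=
  forall x : 'cV[C]_n, x != 0 -> 0 < (x^t* *m A *m x) 0 0.

Definition loewner_le n (A B : 'M[C]_n) : Prop := psdmx (B - A).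

(* Only the coefficients A 0, ..., A m are used. *)
Definition mxpoly_eval n (m : nat) (A : nat -> 'M[C]_n) (z : C) : 'M[C]_n :=
  \sum_(i < m.+1) z ^+ i *: A i.

Definition mxpoly_eigenvalue n (m : nat) (A : nat -> 'M[C]_n) (z : C) : Prop :=
  exists x : 'cV[C]_n, x != 0 /\ mxpoly_eval m A z *m x = 0.

Definition is_smallest_eigenvalue n (A : 'M[C]_n) (a : C) : Prop :=
  eigenvalue A a /\ forall b, eigenvalue A b -> a <= b.

Definition is_largest_eigenvalue n (A : 'M[C]_n) (a : C) : Prop :=
  eigenvalue A a /\ forall b, eigenvalue A b -> b <= a.

(* The default value 0 is not reached on positive semidefinite matrices of
   positive size: see [lambda_minP] and [lambda_maxP]. *)
Definition lambda_min n (A : 'M[C]_n) : C :=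
  xget 0 [set a | is_smallest_eigenvalue A a].

Definition lambda_max n (A : 'M[C]_n) : C :=
  xget 0 [set a | is_largest_eigenvalue A a].

Lemma psdmx_eigenvalue_ge0 n (A : 'M[C]_n) a :
  psdmx A -> eigenvalue A a -> 0 <= a.
Proof.
move=> psdA /eigenvalueP [v vA v0].
have := psdA (v^t*); rewrite trmxCK vA -scalemxAl mxE => h.
suff vv : 0 < (v *m v^t*) 0 0 by rewrite pmulr_lge0 in h.
rewrite mxE lt_neqAle; apply/andP; split; last first.
  by apply: sumr_ge0 => i _; rewrite !mxE mul_conjC_ge0.
apply: contra_neq v0 => /esym /eqP.
rewrite psumr_eq0; last by move=> i _; rewrite !mxE mul_conjC_ge0.
move=> /allP h0; apply/rowP => i; rewrite mxE.
have := h0 i (mem_index_enum i).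
by rewrite !mxE mul_conjC_eq0 => /eqP.
Qed.

Lemma eigenvalue_seq n (A : 'M[C]_n) : (0 < n)%N ->
  exists a (s : seq C), forall b, eigenvalue A b = (b \in a :: s).
Proof.
move=> n0; have [s sE] := closed_field_poly_normal (char_poly A).
move: sE; rewrite (monicP (char_poly_monic A)) scale1r => sE.
have szs : size s = n.
  by have := size_char_poly A; rewrite sE size_prod_XsubC => -[].
have eigE b : eigenvalue A b = (b \in s).
  by rewrite eigenvalue_root_char sE root_prod_XsubC.
case: s {sE} szs eigE => [|a s] szs eigE; first by rewrite -szs in n0.
by exists a, s.
Qed.

Lemma seq_extrema (a : C) (s : seq C) : {in a :: s, forall b, 0 <= b} ->
  (exists2 c, c \in a :: s & {in a :: s, forall b, c <= b}) /\
  (exists2 c, c \in a :: s & {in a :: s, forall b, b <= c}).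
Proof.
elim: s a => [|b s IHs] a h.
  by split; exists a; rewrite ?mem_head// => c; rewrite inE => /eqP ->.
have [|[c cs cmin] [d ds dmax]] := IHs b.
  by move=> x xs; apply: h; rewrite inE xs orbT.
have a0 : a \is Num.real by rewrite ger0_real// h// mem_head.
have r x : x \in b :: s -> x \is Num.real.
  by move=> xs; rewrite ger0_real// h// inE xs orbT.
split.
- have [ac|ca] := real_leP a0 (r _ cs).
  + exists a; rewrite ?mem_head// => x; rewrite inE => /predU1P[->//|xs].
    exact: le_trans ac (cmin _ xs).
  + exists c; first by rewrite inE cs orbT.
    by move=> x; rewrite inE => /predU1P[->|/cmin//]; exact: ltW.
- have [da|ad] := real_leP (r _ ds) a0.
  + exists a; rewrite ?mem_head// => x; rewrite inE => /predU1P[->//|xs].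
    exact: le_trans (dmax _ xs) da.
  + exists d; first by rewrite inE ds orbT.
    by move=> x; rewrite inE => /predU1P[->|/dmax//]; exact: ltW.
Qed.

Lemma lambda_minP n (A : 'M[C]_n) : (0 < n)%N -> psdmx A ->
  is_smallest_eigenvalue A (lambda_min A).
Proof.
move=> n0 psdA; have [a [s eigE]] := eigenvalue_seq A n0.
have [|[c cs cmin] _] := @seq_extrema a s.
  by move=> b; rewrite -eigE; exact: psdmx_eigenvalue_ge0.
apply: (@xgetPex _ 0 [set a | is_smallest_eigenvalue A a]); exists c; split.
  by rewrite eigE.
by move=> b; rewrite eigE => /cmin.
Qed.

Lemma lambda_maxP n (A : 'M[C]_n) : (0 < n)%N -> psdmx A ->
  is_largest_eigenvalue A (lambda_max A).
Proof.
move=> n0 psdA; have [a [s eigE]] := eigenvalue_seq A n0.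
have [|_ [c cs cmax]] := @seq_extrema a s.
  by move=> b; rewrite -eigE; exact: psdmx_eigenvalue_ge0.
apply: (@xgetPex _ 0 [set a | is_largest_eigenvalue A a]); exists c; split.
  by rewrite eigE.
by move=> b; rewrite eigE => /cmax.
Qed.

End Defs.

(* Main.v *)
Require Import Defs.
From mathcomp Require Import all_boot all_order all_algebra.
From mathcomp Require Import reals complex.
From mathcomp Require Import ring.
Import Order.TTheory GRing.Theory Num.Theory.
Local Open Scope ring_scope.

(** Testing the equation [P(lambda) x = 0] against [x] itself turns it into a
    scalar one: the numbers [a i = x^* A_i x] form a nondecreasing sequence of
    nonnegative reals with [a m > 0], and [\sum_i a i * lambda ^ i = 0].  The
    upper bound is then the theorem of Enestrom and Kakeya.  Multiplying the
    polynomial by [1 - lambda] makes the nonnegative increments of [a] appear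
    ([mul_oneBz_poly]), with
      [a m * lambda ^ m.+1 =
         a 0 + \sum_(i < m) (a i.+1 - a i) * lambda ^ i.+1].
    As the increments add up to [a m - a 0], taking norms excludes
    [`|lambda| > 1] ([enestrom_kakeya]).  Once [`|lambda| <= 1] is known, every
    term of that equation other than [a 0] is at most its coefficient times
    [`|lambda|], which gives [a 0 <= 2 * a m * `|lambda|]
    ([enestrom_kakeya_lower]).

    Comparing [a 0] and [a m] with the extreme eigenvalues is the Rayleigh
    quotient estimate: a positive semidefinite matrix is Hermitian by
    polarization ([psdmx_hermsym]), so it is unitarily diagonalizable, and its
    quadratic form is a combination of its eigenvalues with nonnegative weights
    of total [x^* x] ([normal_qform]). *)

(** * Roots of a polynomial with nondecreasing coefficients *)

Section EnestromKakeya.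
Set Implicit Arguments.
Unset Strict Implicit.
Context {C : numFieldType}.
Implicit Types (a : nat -> C) (z c : C) (m : nat).

Lemma mul_oneBz_poly a z m :
  (1 - z) * (\sum_(i < m.+1) a i * z ^+ i) =
  a 0%N + \sum_(i < m) (a i.+1 - a i) * z ^+ i.+1 - a m * z ^+ m.+1.
Proof.
elim: m => [|m IHm]; first by rewrite big_ord1 big_ord0; ring.
by rewrite big_ord_recr /= mulrDr IHm [in RHS]big_ord_recr /= !exprS; ring.
Qed.

Lemma norm_increments_le a z m c :
  (forall i, (i < m)%N -> a i <= a i.+1) ->
  (forall i, (i < m)%N -> `|z| ^+ i.+1 <= c) ->
  `|\sum_(i < m) (a i.+1 - a i) * z ^+ i.+1| <= (a m - a 0%N) * c.
Proof.
move=> a_homo zc.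
have -> : a m - a 0%N = \sum_(i < m) (a i.+1 - a i).
  by rewrite -(telescope_sumr a (leq0n m)) big_mkord.
rewrite mulr_suml; apply: le_trans (ler_norm_sum _ _ _) _.
apply: ler_sum => i _; have d0 : 0 <= a i.+1 - a i by rewrite subr_ge0 a_homo.
by rewrite normrM normrX (ger0_norm d0) ler_wpM2l ?zc.
Qed.

(** If [1 < `|z|] then [`|z| ^+ i.+1 <= `|z| ^+ m] for [i < m], so that
    [a m * `|z| ^+ m.+1] is at most
    [(a 0 + (a m - a 0)) * `|z| ^+ m = a m * `|z| ^+ m], which is absurd. *)
Lemma enestrom_kakeya a z m :
  (forall i, (i < m)%N -> a i <= a i.+1) -> 0 <= a 0%N -> 0 < a m ->
  \sum_(i < m.+1) a i * z ^+ i = 0 -> `|z| <= 1.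
Proof.
move=> a_homo a0 am pz0.
have [//|z1] := real_leP (normr_real z) (@real1 C).
have zX k : 1 <= `|z| ^+ k by rewrite exprn_ege1 ?ltW.
have := mul_oneBz_poly a z m; rewrite pz0 mulr0 => /esym/subr0_eq eqz.
have : a m * `|z| ^+ m.+1 <= a m * `|z| ^+ m.
  have -> : a m * `|z| ^+ m.+1 = `|a m * z ^+ m.+1|.
    by rewrite normrM normrX (gtr0_norm am).
  rewrite -eqz; apply: le_trans (ler_normD _ _) _.
  have -> : a m * `|z| ^+ m = a 0%N * `|z| ^+ m + (a m - a 0%N) * `|z| ^+ m.
    by ring.
  apply: lerD; first by rewrite ger0_norm ?ler_peMr.
  by apply: norm_increments_le => // i im; rewrite ler_weXn2l ?ltW.
rewrite ler_pM2l// exprS => h.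
have : `|z| * `|z| ^+ m <= 1 * `|z| ^+ m by rewrite mul1r.
by rewrite ler_pM2r ?lt_geF // (lt_le_trans ltr01 (zX m)).
Qed.

(** Isolating [a 0] in [mul_oneBz_poly] and using [`|z| ^+ k.+1 <= `|z|] gives
    [a 0 <= (a m + (a m - a 0)) * `|z|]; the constant 2 comes from dropping
    [- a 0]. *)
Lemma enestrom_kakeya_lower a z m :
  (forall i, (i < m)%N -> a i <= a i.+1) -> 0 <= a 0%N -> 0 < a m ->
  \sum_(i < m.+1) a i * z ^+ i = 0 -> a 0%N <= 2 * a m * `|z|.
Proof.
move=> a_homo a0 am pz0.
have z1 := enestrom_kakeya a_homo a0 am pz0.
have zX k : `|z| ^+ k.+1 <= `|z|.
  by rewrite exprS ler_piMr ?exprn_ile1.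
have := mul_oneBz_poly a z m; rewrite pz0 mulr0 => /esym/subr0_eq eqz.
pose S := \sum_(i < m) (a i.+1 - a i) * z ^+ i.+1.
rewrite -[a 0%N](ger0_norm a0) -[a 0%N](addrK S).
rewrite eqz; apply: le_trans (ler_normB _ _) _.
have -> : 2 * a m * `|z| = a m * `|z| + ((a m - a 0%N) * `|z| + a 0%N * `|z|).
  by ring.
apply: lerD; first by rewrite normrM normrX (gtr0_norm am) ler_pM2l.
apply: ler_wpDr; first exact: mulr_ge0.
by apply: norm_increments_le => // i _; exact: zX.
Qed.

End EnestromKakeya.

(** * Quadratic forms and the Rayleigh quotient *)

Section Rayleigh.
Set Implicit Arguments.
Unset Strict Implicit.
Context {C : numClosedFieldType}.
Local Open Scope sesquilinear_scope.

Lemma conjC_mxE m n (M : 'M[C]_(m, n)) i j : (M^t*) i j = (M j i)^*.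
Proof. by rewrite !mxE. Qed.

(** Polarization: over the complex numbers, replacing [x + y] by [x + 'i y]
    separates the two mixed terms, so the diagonal values of a sesquilinear
    form determine it. *)
Lemma qform_eq0 n (H : 'M[C]_n) :
  (forall x : 'cV[C]_n, (x^t* *m H *m x) 0 0 = 0) -> H = 0.
Proof.
move=> H0; pose f (x y : 'cV[C]_n) := (x^t* *m H *m y) 0 0.
have fD x y c : f (x + c *: y) (x + c *: y) =
    f x x + c * f x y + c^* * f y x + c^* * c * f y y.
  have cD : (x + c *: y)^t* = x^t* + c^* *: y^t*.
    by apply/matrixP => i j; rewrite !mxE rmorphD rmorphM.
  rewrite /f cD !mulmxDl !mulmxDr.
  by rewrite -!scalemxAl -!scalemxAr -?scalemxAl !mxE; ring.
have f0 x y : f x y = 0.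
  have := fD x y 1; have := fD x y 'i; rewrite /f !H0 conjC1 conjCi -!/(f _ _).
  rewrite !add0r !mulr0 !addr0 !mul1r mulNr -mulrBr => /esym/eqP.
  rewrite mulf_eq0 (negPf (neq0Ci C)) /= subr_eq0 => /eqP <- /esym/eqP.
  by rewrite -mulr2n mulrn_eq0 /= => /eqP.
apply/matrixP => i j; rewrite [RHS]mxE -(f0 (delta_mx i 0) (delta_mx j 0)) /f.
by rewrite trmx_delta map_delta_mx -rowE -colE !mxE.
Qed.

Lemma qform_conj n (A : 'M[C]_n) (x : 'cV[C]_n) :
  (x^t* *m A^t* *m x) 0 0 = ((x^t* *m A *m x) 0 0)^*.
Proof.
rewrite -conjC_mxE !trmx_mul !map_mxM /= mulmxA; congr ((_ *m _) 0 0).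
by rewrite trmxCK.
Qed.

(** A real quadratic form has a vanishing skew-Hermitian part. *)
Lemma psdmx_hermsym n (A : 'M[C]_n) : psdmx A -> A \is hermsymmx.
Proof.
move=> psdA; apply/is_hermitianmxP; rewrite expr0 scale1r.
apply/eqP; rewrite -subr_eq0; apply/eqP/qform_eq0 => x.
rewrite mulmxBr mulmxBl mxE [X in _ + X]mxE qform_conj.
by rewrite (CrealP (ger0_real (psdA x))) subrr.
Qed.

Lemma pdmx_psdmx n (A : 'M[C]_n) : pdmx A -> psdmx A.
Proof.
move=> pdA x; have [->|/pdA/ltW//] := eqVneq x 0.
by rewrite mulmx0 mxE.
Qed.

Lemma sqnorm_gt0 n (x : 'cV[C]_n) : x != 0 -> 0 < (x^t* *m x) 0 0.
Proof.
have w0 i : 0 <= (x^t*) 0 i * x i 0 by rewrite conjC_mxE mulrC mul_conjC_ge0.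
move=> x0; rewrite mxE lt0r sumr_ge0 // andbT.
apply: contra_neq x0 => /eqP; rewrite psumr_eq0 // => /allP wi0.
apply/colP => i; have := wi0 i (mem_index_enum i).
by rewrite conjC_mxE [RHS]mxE mulrC mul_conjC_eq0 => /eqP.
Qed.

(** In the orthonormal eigenbasis given by the spectral theorem, the weights are
    the squared moduli of the coordinates of [x]. *)
Lemma normal_qform n (A : 'M[C]_n) (x : 'cV[C]_n) : A \is normalmx ->
  exists d w : 'I_n -> C,
    [/\ forall i, eigenvalue A (d i), forall i, 0 <= w i,
        (x^t* *m A *m x) 0 0 = \sum_i d i * w i
      & (x^t* *m x) 0 0 = \sum_i w i].
Proof.
move=> /orthomx_spectralP; set P := spectralmx A; set d := spectral_diag A.
have Pu : P \is unitarymx := spectral_unitarymx A.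
have Punit := unitarymx_unit Pu.
move=> eA; pose y := P *m x.
have yE : y^t* = x^t* *m invmx P.
  by rewrite trmx_mul map_mxM /= invmx_unitary.
exists (fun i => d 0 i), (fun i => y i 0 * (y i 0)^*); split.
- move=> i; apply/eigenvalueP; exists (row i P).
    rewrite {1}eA -row_mul !mulmxA mulmxV // mul1mx.
    by rewrite row_mul row_diag_mx -scalemxAl -rowE.
  apply/eqP => ri0; have : row i (P *m invmx P) = 0 by rewrite row_mul ri0 mul0mx.
  by rewrite mulmxV // => /rowP/(_ i)/eqP; rewrite !mxE eqxx oner_eq0.
- by move=> i; rewrite mul_conjC_ge0.
- have -> : x^t* *m A *m x = y^t* *m (diag_mx d *m y).
    by rewrite yE {1}eA !mulmxA.
  rewrite mxE; apply: eq_bigr => i _.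
  by rewrite mul_diag_mx conjC_mxE !mxE mulrCA [_^* * _]mulrC.
- have -> : x^t* *m x = y^t* *m y by rewrite yE mulmxA mulmxKV.
  by rewrite mxE; apply: eq_bigr => i _; rewrite conjC_mxE mulrC.
Qed.

Lemma lambda_min_rayleigh n (A : 'M[C]_n) (x : 'cV[C]_n) :
  (0 < n)%N -> psdmx A ->
  lambda_min A * (x^t* *m x) 0 0 <= (x^t* *m A *m x) 0 0.
Proof.
move=> n0 psdA; have [_ min_le] := lambda_minP n0 psdA.
have [d [w [dA w0 -> ->]]] :=
  normal_qform x (hermitian_normalmx (psdmx_hermsym psdA)).
by rewrite mulr_sumr; apply: ler_sum => i _; rewrite ler_wpM2r ?min_le.
Qed.

Lemma lambda_max_rayleigh n (A : 'M[C]_n) (x : 'cV[C]_n) :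
  (0 < n)%N -> psdmx A ->
  (x^t* *m A *m x) 0 0 <= lambda_max A * (x^t* *m x) 0 0.
Proof.
move=> n0 psdA; have [_ max_ge] := lambda_maxP n0 psdA.
have [d [w [dA w0 -> ->]]] :=
  normal_qform x (hermitian_normalmx (psdmx_hermsym psdA)).
by rewrite mulr_sumr; apply: ler_sum => i _; rewrite ler_wpM2r ?max_ge.
Qed.

Lemma qform_mxpoly_eval n m (A : nat -> 'M[C]_n) z (x : 'cV[C]_n) :
  (x^t* *m mxpoly_eval m A z *m x) 0 0 =
  \sum_(i < m.+1) (x^t* *m A i *m x) 0 0 * z ^+ i.
Proof.
rewrite /mxpoly_eval mulmx_sumr mulmx_suml summxE; apply: eq_bigr => i _.
by rewrite -scalemxAr -scalemxAl mxE mulrC.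
Qed.

End Rayleigh.

(** * Localization of the eigenvalues *)

Theorem theorem2p3 (R : realType) (m n : nat) (A : nat -> 'M[R[i]]_n) :
  (1 <= m)%N -> (1 <= n)%N ->
  (forall i : nat, (i < m)%N -> loewner_le (A i) (A i.+1)) ->
  loewner_le 0 (A 0%N) ->
  pdmx (A m) ->
  forall lambda : R[i], mxpoly_eigenvalue m A lambda ->
    lambda_min (A 0%N) / (2 * lambda_max (A m)) <= `|lambda| <= 1.
Proof.
move=> _ n0 A_homo A0_ge0 pdAm lambda [x [x0 Px0]].
have psdA0 : psdmx (A 0%N) by move=> u; have := A0_ge0 u; rewrite subr0.
have psdAm := pdmx_psdmx pdAm.
pose a i := (x^t* *m A i *m x)%sesqui 0 0.
have a_homo i : (i < m)%N -> a i <= a i.+1.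
  move=> im; rewrite -subr_ge0; have := A_homo i im x.
  by rewrite mulmxBr mulmxBl mxE [X in _ + X]mxE.
have a0 : 0 <= a 0%N := psdA0 x.
have am : 0 < a m := pdAm x x0.
have pz0 : \sum_(i < m.+1) a i * lambda ^+ i = 0.
  by rewrite -qform_mxpoly_eval -mulmxA Px0 mulmx0 mxE.
apply/andP; split; last exact: enestrom_kakeya a_homo a0 am pz0.
have xx := sqnorm_gt0 x0; have amax := lambda_max_rayleigh x n0 psdAm.
have max0 : 0 < lambda_max (A m).
  by have := lt_le_trans am amax; rewrite pmulr_lgt0.
rewrite ler_pdivrMr ?mulr_gt0// -(ler_pM2r xx).
apply: le_trans (lambda_min_rayleigh x n0 psdA0) _.
apply: le_trans (enestrom_kakeya_lower a_homo a0 am pz0) _.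
have -> (r l s : R[i]) : r * (2 * l) * s = 2 * (l * s) * r by ring.
by rewrite ler_wpM2r ?ler_pM2l.
Qed.
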